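(* Let $G$ be a $\Delta$-critical graph. If $\Delta\in\{2,3,4,5,6,7,8\}$, then $\overline{d}(G)\ge \frac{2\Delta+2}{3}$.
   Context: All graphs are finite, undirected, loopless, and may contain parallel edges. Degrees count parallel edges separately; $\Delta(G)$ is the maximum degree and $\overline{d}(G)=2|E(G)|/|V(G)|$ is the average degree. The chromatic index $\chi'(G)$ is the least $k$ such that $E(G)$ can be partitioned into $k$ matchings. $G$ is critical if $\chi'(H)<\chi'(G)$ for every proper subgraph $H$ of $G$. $G$ is $\Delta$-critical if $\Delta(G)=\Delta$, $\chi'(G)=\Delta+1$, and $G$ is critical. *)

(* Defs.v *)
From mathcomp Require Import all_boot all_order all_algebra.

Set Implicit Arguments.
Unset Strict Implicit.
Unset Printing Implicit Defensive.

Import GRing.Theory Num.Theory.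

(* Finite loopless multigraphs whose vertices and edges are drawn from ambient
   finite types V and E, so that a graph and its subgraphs have the same type.
   Edges are named, and distinct edges may have the same pair of ends. The value
   of [ends] outside [eset] is irrelevant. *)
Record mgraph (V E : finType) := MGraph {
  vset : {set V};
  eset : {set E};
  ends : E -> {set V};
  ends_sub : forall e, e \in eset -> ends e \subset vset;
  card_ends : forall e, e \in eset -> #|ends e| = 2
}.

Section MGraphTheory.
Variables V E : finType.
Implicit Types G H : mgraph V E.

Definition degree G (x : V) : nat := #|[set e in eset G | x \in ends G e]|.

Definition max_degree G : nat := \max_(x in vset G) degree G x.

Definition average_degree G : rat :=
  ((2 * #|eset G|)%:R / #|vset G|%:R)%R.

Definition matching G (M : {set E}) : bool :=
  (M \subset eset G) &&
  [forall e in M, forall f in M, (e != f) ==> [disjoint ends G e & ends G f]].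

Definition matching_partition G (k : nat) : bool :=
  [exists P : {set {set E}},
    [&& partition P (eset G), #|P| == k & [forall M in P, matching G M]]].

Lemma matching_partition_ex G : exists k, matching_partition G k.
Proof.
pose P := [set [set e] | e in eset G].
exists #|P|; apply/existsP; exists P; apply/and3P; split=> //.
- apply/and3P; split.
  + rewrite cover_imset; apply/eqP/setP => x.
    apply/bigcupP/idP => [[e eG]|xG]; first by rewrite inE => /eqP->.
    by exists x; rewrite ?inE.
  + apply/trivIsetP => _ _ /imsetP[e _ ->] /imsetP[f _ ->] nef.
    by rewrite disjoints1 inE; apply: contra nef => /eqP->.
  + by apply/imsetP => -[e _ /setP/(_ e)]; rewrite !inE eqxx.
apply/forall_inP => _ /imsetP[e eG ->]; rewrite /matching sub1set eG /=.
apply/forall_inP => x /set1P->; apply/forall_inP => y /set1P->.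
by rewrite eqxx.
Qed.

Definition chromatic_index G : nat := ex_minn (matching_partition_ex G).

Definition subgraph H G : Prop :=
  [/\ vset H \subset vset G, eset H \subset eset G
    & forall e, e \in eset H -> ends H e = ends G e].

Definition proper_subgraph H G : Prop :=
  subgraph H G /\ ~ (vset H = vset G /\ eset H = eset G).

Definition critical G : Prop :=
  forall H, proper_subgraph H G -> chromatic_index H < chromatic_index G.

Definition delta_critical (D : nat) G : Prop :=
  [/\ max_degree G = D, chromatic_index G = D.+1 & critical G].

End MGraphTheory.

(* Main.v *)
Require Import Defs.
From mathcomp Require Import all_boot all_order all_algebra.
From mathcomp Require Import perm zify.

Set Implicit Arguments.
Unset Strict Implicit.
Unset Printing Implicit Defensive.

Import GRing.Theory Num.Theory.

(** Write [d] for the degree and [mu u v] for the number of edges joining [u]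
    and [v]. The proof is a discharging argument fed by Vizing's multifans.

    By criticality every edge [e = cx] leaves behind a [D]-edge-colouring of
    [G - e], while [G] has none. From the uncoloured edge one grows a fan [F] of
    neighbours of [c]: it contains [x], and whenever a colour missing at a
    vertex of [F] is used by an edge at [c], the other end of that edge is in
    [F] too. Moving the uncoloured edge along the fan shows that no colour is
    missing both at [c] and at a vertex of [F] ([fan_center]), and Kempe changes
    that no colour is missing at two vertices of [F] ([fan_elementary]).
    Counting colours yields [fan_inequalities]: [c] and [F] have large degrees
    on average, and many edges join [c] to [F]. A consequence used throughout is
    [adjacency]: a neighbour [x] of [v] forces more than [D - d x] edges from [v]
    to vertices of degree at least [2D + 2 - d v - d x].

    Now give every vertex [v] the charge [d v - (2D + 2) / 3]; the claim is that
    the total charge is nonnegative. A vertex of negative charge is sent the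
    amount [share] along each edge leading to a vertex of positive charge. Fix
    [D] and [d v], and record how many edges [v] sends to vertices of each
    degree. Then [adjacency] and the nonnegativity of the final charge at [v]
    become linear conditions on these few numbers, and the former imply the
    latter ([degree_counts_balance]) except in two configurations, with [D = 7]
    and [D = 8]. There [v] is adjacent to vertices of degree 5, and the full fan
    inequalities bound what it sends ([sent_fat7], [sent_twin8]).

    The bound is attained by the triangles with edge multiplicities [a], [b], [1]
    where [a + b = D], so the rule can waste nothing on them. When these are 3, 4
    and 1, the vertex of degree 7 must give up all its charge, four fifths of it
    along the three edges to the vertex of degree 4. This is why [share] is not
    just an equal split and why it distinguishes [rich] vertices. *)

(** * Orbits of two involutions *)

(** With [s] the composition of [A] and [B], the orbit of [c] under [s] is stable
    under [A] and [B], because [A] reverses [s] and fixes [c]. If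
    [s^i c] and [s^j c] are fixed by [B], then [s^(2i) c = s c = s^(2j) c], and
    computing [s^(2ij) c] in two ways gives [s^i c = s^j c]. For the involutions
    exchanging the ends of the edges of two given colours, this says that an
    alternating path has only two ends. *)
Lemma involution_orbit (T : finType) (A B : T -> T) (c : T) :
    involutive A -> involutive B -> A c = c ->
  exists K : {set T},
    [/\ c \in K, forall v, v \in K -> A v \in K, forall v, v \in K -> B v \in K &
        forall u v, u \in K -> v \in K -> B u = u -> B v = v -> u = v].
Proof.
move=> AK BK Ac; pose s v := B (A v).
have injs : injective s by apply: inj_comp; apply: can_inj.
have sAs w : s (A (s w)) = A w by rewrite /s AK BK.
have back i : iter i s (A (iter i s c)) = c.
  by elim: i => // i IH; rewrite iterSr iterS sAs.
have KA v : fconnect s c v -> fconnect s c (A v).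
  move=> /iter_findex <-; rewrite fconnect_sym //.
  have := fconnect_iter s (findex s c v) (A (iter (findex s c v) s c)).
  by rewrite back.
have fixB i : B (iter i s c) = iter i s c -> iter (i + i) s c = s c.
  move=> Bi; rewrite iterD.
  have {1}<- : s (A (iter i s c)) = iter i s c by rewrite /s AK.
  by rewrite -iterSr iterS back.
have iter_mul m j : iter m s c = s c -> iter (j * m) s c = iter j s c.
  move=> Em; elim: j => // j IH; rewrite mulSn iterD IH -iterD addnC iterD Em.
  by rewrite -iterSr.
exists [set v | fconnect s c v]; split.
- by rewrite inE connect0.
- by move=> v; rewrite !inE; apply: KA.
- move=> v; rewrite !inE => cv; apply: connect_trans (KA _ cv) _.
  by apply: connect1; rewrite /= /s AK.
move=> u v; rewrite !inE => /iter_findex <- /iter_findex <-.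
move: (findex s c u) (findex s c v) => i j /fixB Ei /fixB Ej.
rewrite -(iter_mul _ i Ej) -(iter_mul _ j Ei).
by congr (iter _ s c); rewrite !addnn -!doubleMr mulnC.
Qed.

(** * Finite sums *)

Lemma card_bigcup_disjoint (I T : finType) (P : {set I}) (A : I -> {set T}) :
    (forall i j b, i \in P -> j \in P -> b \in A i -> b \in A j -> i = j) ->
  #|\bigcup_(i in P) A i| = \sum_(i in P) #|A i|.
Proof.
move=> dA; rewrite -sum1_card big_mkcond /=.
under [RHS]eq_bigr do rewrite -sum1_card big_mkcond /=.
rewrite exchange_big /=; apply: eq_bigr => b _.
case: bigcupP => [[i iP bi]|nb].
  rewrite (bigD1 i) //= bi big1 // => j /andP[jP nji].
  by case: ifP => // bj; rewrite (dA _ _ _ jP iP bj bi) eqxx in nji.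
by rewrite big1 // => i iP; case: ifP => // bi; case: nb; exists i.
Qed.

Lemma sum2_leq (T : finType) (F : {set T}) (h : T -> nat) x y :
  x \in F -> y \in F -> y != x -> h x + h y <= \sum_(z in F) h z.
Proof.
move=> xF yF nyx; rewrite (bigD1 x) //= leq_add2l.
by rewrite (bigD1 y) ?yF ?nyx //= leq_addr.
Qed.

Lemma sum3_leq (T : finType) (F : {set T}) (h : T -> nat) x y z :
  x \in F -> y \in F -> z \in F -> y != x -> z != x -> z != y ->
  h x + h y + h z <= \sum_(w in F) h w.
Proof.
move=> xF yF zF nyx nzx nzy; rewrite (bigD1 x) //= -addnA leq_add2l.
rewrite (bigD1 y) ?yF ?nyx //= leq_add2l.
by rewrite (bigD1 z) ?zF ?nzx //= leq_addr.
Qed.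

(** * Edges at a vertex *)

Section Multiplicity.
Variables (V E : finType) (G : mgraph V E).

Definition mu (u v : V) := #|[set f in eset G | ends G f == [set u; v]]|.

Definition star (v : V) (S : {set V}) : {set E} :=
  \bigcup_(w in S) [set f in eset G | ends G f == [set v; w]].

Lemma muC u v : mu u v = mu v u.
Proof. by rewrite /mu setUC. Qed.

Lemma ends_neq f u v : f \in eset G -> ends G f = [set u; v] -> u != v.
Proof. by move=> /card_ends + ef; rewrite ef cards2; case: eqP. Qed.

Lemma ends_pair f u v : f \in eset G -> u \in ends G f -> v \in ends G f ->
  v != u -> ends G f = [set u; v].
Proof.
move=> fG uf vf nuv; apply/esym/eqP.
by rewrite eqEcard subUset !sub1set uf vf cards2 eq_sym nuv card_ends.
Qed.

Lemma ends_other f u : f \in eset G -> u \in ends G f ->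
  exists2 v, v != u & ends G f = [set u; v].
Proof.
move=> fG uf; have /card_gt0P[v /setD1P[vu vf]] : 0 < #|ends G f :\ u|.
  by have := cardsD1 u (ends G f); rewrite uf card_ends //; lia.
by exists v => //; apply: ends_pair.
Qed.

Lemma set2_injr (u v w : V) : u != v -> [set u; v] = [set u; w] -> v = w.
Proof.
move=> uv /setP/(_ v); rewrite !inE eqxx orbT eq_sym (negPf uv) /=.
by move/esym/eqP.
Qed.

Lemma in_star f v w S : f \in eset G -> ends G f = [set v; w] ->
  (f \in star v S) = (w \in S).
Proof.
move=> fG ef; apply/bigcupP/idP => [[u uS]|wS]; last first.
  by exists w; rewrite // inE fG ef eqxx.
rewrite inE fG ef => /eqP /set2_injr-> //; exact: ends_neq ef.
Qed.

Lemma card_star v S : #|star v S| = \sum_(w in S) mu v w.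
Proof.
apply: card_bigcup_disjoint => i j f _ _; rewrite !inE.
move=> /andP[fG /eqP ef] /andP[_ /eqP ef'].
by apply: (set2_injr (ends_neq fG ef)); rewrite -ef.
Qed.

Lemma degree_mu v : degree G v = \sum_w mu v w.
Proof.
rewrite (eq_bigl (fun w => w \in setT)) => [|w]; last by rewrite inE.
rewrite -card_star /degree; apply: eq_card => f; rewrite inE.
apply/andP/bigcupP => [[fG /(ends_other fG)[w _ ef]]|[w _]].
  by exists w; rewrite // inE fG ef eqxx.
by rewrite inE => /andP[-> /eqP->]; rewrite set21.
Qed.

End Multiplicity.

(** * Multifans *)

Section Fans.
Variables (V E : finType) (G : mgraph V E) (C : finType).
Implicit Types (e f g : E) (u v c x z : V) (a b : C) (phi : E -> C).

Local Notation ends := (ends G).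
Local Notation eset := (eset G).

Definition proper_on (A : {set E}) phi :=
  forall f g, f \in A -> g \in A -> f != g -> phi f = phi g ->
  [disjoint ends f & ends g].

(** Relative to a colouring of [G - e], so the colour of [e] is ignored. *)
Definition missing phi e v : {set C} :=
  [set a | [forall f in eset :\ e, (v \in ends f) ==> (phi f != a)]].

(** One step of fan growth at the centre [c]: some colour missing at [u] is
    carried by an edge from [c] to [v]. *)
Definition hop phi e c : rel V := fun u v =>
  [exists f in eset :\ e, (ends f == [set c; v]) && (phi f \in missing phi e u)].

Lemma missingP phi e v a :
  reflect (forall f, f \in eset :\ e -> v \in ends f -> phi f != a)
          (a \in missing phi e v).
Proof.
rewrite inE; apply: (iffP forall_inP) => H f fe; first exact/implyP/H.
by apply/implyP; apply: H.
Qed.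

Lemma proper_eq A phi f g v : proper_on A phi -> f \in A -> g \in A ->
  v \in ends f -> v \in ends g -> phi f = phi g -> f = g.
Proof.
move=> P fA gA vf vg eq_fg; apply/eqP/negPn/negP => nfg.
by have /disjointFr /(_ vf) := P f g fA gA nfg eq_fg; rewrite vg.
Qed.

Hypothesis uncolorable : forall phi, ~ proper_on eset phi.

(** Induction along the path, for varying uncoloured edge. If [f] is the edge
    from [c] to the second vertex [z] of the path, its colour is missing at [x];
    giving it to [e] and uncolouring [f] produces a colouring of [G - f] for
    which the rest of the path is still a fan path, since only [x] has lost a
    missing colour. When the path is reduced to [x], a colour missing at both
    ends of [e] would extend the colouring to [G]. *)
Lemma fan_path_center p : forall phi e c x,
    e \in eset -> ends e = [set c; x] -> proper_on (eset :\ e) phi ->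
    uniq (x :: p) -> path (hop phi e c) x p ->
  [disjoint missing phi e c & missing phi e (last x p)].
Proof.
elim: p => [|z p IH] phi e c x eG ee P /=.
  move=> _ _; rewrite -setI_eq0; apply/eqP/setP => a; rewrite in_setI in_set0.
  apply/negP => /andP[/missingP ca /missingP xa].
  pose psi g := if g == e then a else phi g.
  have key h : h \in eset -> h != e -> phi h = a -> [disjoint ends e & ends h].
    move=> hG he ha; have hA : h \in eset :\ e by rewrite !inE he.
    rewrite ee -setI_eq0; apply/eqP/setP => w; rewrite !inE.
    apply/negP => /andP[/orP[] /eqP-> wh].
      by have := ca _ hA wh; rewrite ha eqxx.
    by have := xa _ hA wh; rewrite ha eqxx.
  apply: (@uncolorable psi) => f g fG gG nfg; rewrite /psi.
  have [fe|fe] := eqVneq f e; have [ge|ge] := eqVneq g e.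
  - by rewrite fe ge eqxx in nfg.
  - by move=> ga; rewrite fe; apply: key.
  - by move=> fa; rewrite ge disjoint_sym; apply: key.
  - by apply: P; rewrite // !inE ?fe ?ge.
case/andP => xzp uzp /andP[/exists_inP[f fA /andP[/eqP ef /missingP fx]] pzp].
have /setD1P[fe fG] := fA; have [cx cz] := (ends_neq eG ee, ends_neq fG ef).
have cf : c \in ends f by rewrite ef !inE eqxx.
pose psi g := if g == e then phi f else phi g.
have Ppsi : proper_on (eset :\ f) psi.
  have key h : h \in eset -> h != f -> h != e -> phi f = phi h ->
      [disjoint ends e & ends h].
    move=> hG hf he fh; have hA : h \in eset :\ e by rewrite !inE he.
    rewrite ee -setI_eq0; apply/eqP/setP => w; rewrite !inE.
    apply/negP => /andP[/orP[] /eqP-> wh].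
      by move: hf; rewrite (proper_eq P fA hA cf wh fh) eqxx.
    by have := fx _ hA wh; rewrite fh eqxx.
  move=> g h /setD1P[gf gG] /setD1P[hf hG] ngh; rewrite /psi.
  have [ge|ge] := eqVneq g e; have [he|he] := eqVneq h e.
  - by rewrite ge he eqxx in ngh.
  - by move=> fh; rewrite ge; apply: key.
  - by move=> fh; rewrite he disjoint_sym; apply: key.
  - by apply: P; rewrite // !inE ?he ?ge.
have sub u : u != x -> missing phi e u \subset missing psi f u.
  move=> ux; apply/subsetP => a /missingP ua; apply/missingP => h /setD1P[hf hG].
  rewrite /psi; have [->|he] := eqVneq h e; last by apply: ua; rewrite !inE he.
  by rewrite ee !inE (negPf ux) orbF => /eqP uc; apply: ua; rewrite // uc.
have lx : last z p != x.
  by apply: contraNneq xzp => <-; apply: mem_last.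
apply: disjointWl (sub _ cx) _; apply: disjointWr (sub _ lx) _.
apply: IH => //.
have tr : forall q w, w != x -> x \notin q -> z \notin q ->
    path (hop phi e c) w q -> path (hop psi f c) w q.
  have zx : z != x by apply: contraNneq xzp => ->; rewrite mem_head.
  elim=> //= v q IHq w wx; rewrite !inE !negb_or => /andP[xv xq] /andP[zv zq].
  case/andP => /exists_inP[g gA /andP[/eqP eg gw]] pq.
  apply/andP; split; last by apply: IHq; rewrite // eq_sym.
  have /setD1P[ge gG] := gA; have cv := ends_neq gG eg.
  have gf : g != f.
    apply/eqP => gf; move: eg; rewrite gf ef => /setP/(_ v).
    by rewrite !inE eqxx orbT ![v == _]eq_sym (negPf cv) (negPf zv).
  have psig : psi g = phi g by rewrite /psi (negPf ge).
  apply/exists_inP; exists g; first by rewrite !inE gf.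
  rewrite eg eqxx psig; exact: (subsetP (sub w wx)).
case/andP: uzp => zp _; move: xzp; rewrite inE negb_or => /andP[xz xp].
by apply: tr; rewrite // eq_sym.
Qed.

Definition fan phi e c x : {set V} := [set z | connect (hop phi e c) x z].

Lemma fan_center phi e c x z :
    e \in eset -> ends e = [set c; x] -> proper_on (eset :\ e) phi ->
    z \in fan phi e c x ->
  [disjoint missing phi e c & missing phi e z].
Proof.
move=> eG ee P; rewrite inE => /connectP[p xp ->].
by case/shortenP: xp => p' xp' up' _; apply: fan_path_center.
Qed.

(** The hypothesis on [K] makes it a union of [a]/[b] components, so that
    exchanging [a] and [b] outside [K] gives a proper colouring. If some vertex of
    a fan path misses [b] and is not in [K], let [z] be the first one. The
    exchange preserves the path up to [z], because its earlier vertices missing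
    [b] lie in [K], but makes [z] miss [a], as the centre does, against
    [fan_center]. *)
Lemma fan_linked phi e c x a b (K : {set V}) z :
    e \in eset -> ends e = [set c; x] -> proper_on (eset :\ e) phi ->
    (forall f u v, f \in eset :\ e -> phi f \in [set a; b] ->
       u \in ends f -> v \in ends f -> u \in K -> v \in K) ->
    c \in K -> a \in missing phi e c ->
    z \in fan phi e c x -> b \in missing phi e z -> z \in K.
Proof.
move=> eG ee P clK cK ac.
pose psi f := if [disjoint ends f & K] then tperm a b (phi f) else phi f.
have psiE f v : f \in eset :\ e -> v \in ends f ->
    psi f = if v \in K then phi f else tperm a b (phi f).
  move=> fA vf; rewrite /psi; case: ifPn => [dK | ndK].
    by rewrite (disjointFr dK vf).
  case: ifPn => // vK; have [Ef|Ef] := boolP (phi f \in [set a; b]); last first.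
    by move: Ef; rewrite !inE negb_or => /andP[? ?]; rewrite tpermD // eq_sym.
  case/negP: ndK; rewrite -setI_eq0; apply/eqP/setP => w; rewrite in_setI in_set0.
  by apply: contraNF vK => /andP[wf wK]; apply: (clK f w v).
have Ppsi : proper_on (eset :\ e) psi.
  move=> f g fA gA nfg Efg; rewrite -setI_eq0; apply/eqP/setP => v.
  rewrite in_setI in_set0; apply/andP => -[vf vg]; case/eqP: nfg.
  apply: (proper_eq P fA gA vf vg); move: Efg.
  by rewrite (psiE f v) // (psiE g v) //; case: ifP => // _ /perm_inj.
have missK u : u \in K -> missing phi e u = missing psi e u.
  move=> uK; apply/setP => d; apply/missingP/missingP => H f fA uf;
    by have := H f fA uf; rewrite (psiE f u) // uK.
have missN u d : u \notin K -> d \in missing phi e u ->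
    tperm a b d \in missing psi e u.
  move=> uK /missingP H; apply/missingP => f fA uf.
  by rewrite (psiE f u) // (negPf uK) (inj_eq perm_inj); apply: H.
rewrite inE => /connectP[p xp ->].
suff H : all (fun v => (b \in missing phi e v) ==> (v \in K)) (x :: p).
  by move: (allP H (last x p) (mem_last x p)) => /implyP.
have hopE u v : (b \in missing phi e u) ==> (u \in K) ->
    hop phi e c u v -> hop psi e c u v.
  move=> uK /exists_inP[g gA /andP[/eqP eg gu]]; apply/exists_inP; exists g => //.
  have cg : c \in ends g by rewrite eg !inE eqxx.
  rewrite eg eqxx (psiE g c) // cK /=.
  have [uK'|nuK] := boolP (u \in K); first by rewrite -missK.
  rewrite (negPf nuK) implybF in uK; have := missN u _ nuK gu.
  rewrite tpermD //; first by rewrite eq_sym; move/missingP: ac; apply.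
  by apply: contraNneq uK => ->.
have last_ok q : path (hop psi e c) x q ->
    (b \in missing phi e (last x q)) ==> (last x q \in K).
  move=> xq; apply/implyP => bz; apply: contraT => zK.
  have zF : last x q \in fan psi e c x by rewrite inE; apply/connectP; exists q.
  have := missN _ _ zK bz; rewrite tpermR.
  by rewrite (disjointFr (fan_center eG ee Ppsi zF)) // -missK.
elim/last_ind: p xp => [|p v IH]; first by rewrite /= andbT (last_ok [::]).
rewrite rcons_path -rcons_cons all_rcons => /andP[xp pv].
have {}IH := IH xp; rewrite IH andbT.
have := last_ok (rcons p v); rewrite last_rcons; apply.
rewrite rcons_path (hopE _ _ _ pv) ?andbT; last first.
  exact: (allP IH) (mem_last x p).
by apply: (sub_in_path _ IH xp) => u w uP _; apply: hopE.
Qed.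

(** The involution exchanging the two ends of every edge of colour [a]; the
    default makes it fix the vertices where [a] is missing. *)
Definition mate phi e a v : V :=
  odflt v [pick u | [exists f in eset :\ e, (phi f == a) && (ends f == [set v; u])]].

Lemma mateE phi e a f u v : proper_on (eset :\ e) phi -> f \in eset :\ e ->
  phi f = a -> ends f = [set v; u] -> mate phi e a v = u.
Proof.
move=> P fA fa ef; rewrite /mate; case: pickP => [w|] /=; last first.
  by move=> /(_ u)/existsP[]; exists f; rewrite fA fa ef !eqxx.
case/exists_inP => g gA /andP[/eqP ga /eqP eg].
have fg : f = g.
  by apply: (@proper_eq _ _ _ _ v P); rewrite ?ef ?eg ?set21 // fa ga.
have /setD1P[_ gG] := gA.
by apply: (set2_injr (ends_neq gG eg)); rewrite -eg -fg.
Qed.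

Lemma mate_id phi e a v : a \in missing phi e v -> mate phi e a v = v.
Proof.
move=> /missingP va; rewrite /mate; case: pickP => //= w.
case/exists_inP => f fA /andP[/eqP fa /eqP ef].
by have := va f fA; rewrite fa eqxx ef !inE eqxx => /(_ isT).
Qed.

Lemma mateK phi e a : proper_on (eset :\ e) phi -> involutive (mate phi e a).
Proof.
move=> P v; rewrite {2}/mate; case: pickP => [u|] /=.
  case/exists_inP => f fA /andP[/eqP fa /eqP ef].
  by apply: (mateE P fA fa); rewrite setUC.
by move=> none; rewrite /mate; case: pickP => //= w; move: (none w) => /= ->.
Qed.

(** Both vertices would be linked to the centre, hence the [a]/[b] component of
    the centre would have three ends. *)
Lemma fan_elementary phi e c x a b z z' :
    e \in eset -> ends e = [set c; x] -> proper_on (eset :\ e) phi ->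
    a \in missing phi e c -> z \in fan phi e c x -> z' \in fan phi e c x ->
    b \in missing phi e z -> b \in missing phi e z' ->
  z = z'.
Proof.
move=> eG ee P ac zF z'F bz bz'.
have [K [cK clA clB]] := involution_orbit (mateK a P) (mateK b P) (mate_id ac).
have clK f u v : f \in eset :\ e -> phi f \in [set a; b] ->
    u \in ends f -> v \in ends f -> u \in K -> v \in K.
  move=> fA fab uf vf uK; have [->//|nuv] := eqVneq v u.
  have ef : ends f = [set u; v] by apply: ends_pair => //; case/setD1P: fA.
  case/set2P: fab => fc; first by rewrite -(mateE P fA fc ef) clA.
  by rewrite -(mateE P fA fc ef) clB.
by apply; rewrite ?mate_id // (fan_linked eG ee P clK cK ac).
Qed.

Lemma card_missing phi e v : e \in eset -> proper_on (eset :\ e) phi ->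
  #|missing phi e v| + degree G v = #|C| + (v \in ends e).
Proof.
move=> eG P; pose A := [set f in eset :\ e | v \in ends f].
have -> : missing phi e v = ~: (phi @: A).
  apply/setP => a; rewrite in_setC; apply/missingP/negP => [H /imsetP[f]|H f fA vf].
    by rewrite inE => /andP[fA vf] ea; have := H f fA vf; rewrite ea eqxx.
  by apply/eqP => fa; case: H; rewrite -fa imset_f // inE fA.
have injA : {in A &, injective phi}.
  move=> f g; rewrite !inE => /andP[fA vf] /andP[gA vg].
  by apply: (proper_eq P _ _ vf vg); rewrite !inE.
have -> : degree G v = #|A| + (v \in ends e).
  rewrite /degree (cardsD1 e) inE eG addnC; congr (_ + _).
  by apply: eq_card => f; rewrite !inE andbA.
by rewrite addnA; congr (_ + _); rewrite -(card_in_imset injA) addnC cardsC.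
Qed.

(** The colour [b] is present at the centre, and maximality of the fan puts the
    other end of its edge in the fan. This end is not [z], where [b] is
    missing. *)
Lemma fan_colors phi e c x z b :
    e \in eset -> ends e = [set c; x] -> proper_on (eset :\ e) phi ->
    z \in fan phi e c x -> b \in missing phi e z ->
  b \in phi @: (star G c (fan phi e c x :\ z) :\ e).
Proof.
move=> eG ee P zF bz; have := disjointFl (fan_center eG ee P zF) bz.
move/negbT; rewrite inE negb_forall_in => /exists_inP[f fA].
rewrite negb_imply negbK => /andP[cf /eqP fb]; have /setD1P[fe fG] := fA.
have [w wc ef] := ends_other fG cf; apply/imsetP; exists f => //.
rewrite !inE fe (in_star _ fG ef) !inE /=; apply/andP; split.
  apply: contraTneq bz => <-; apply/negP => /missingP/(_ f fA).
  by rewrite fb eqxx ef set22 => /(_ isT).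
rewrite inE in zF; apply: connect_trans zF (connect1 _).
by apply/exists_inP; exists f; rewrite // ef eqxx fb.
Qed.

Lemma fan_neq_center phi e c x z : c != x -> z \in fan phi e c x -> z != c.
Proof.
rewrite inE => cx /connectP[p + ->]; case/lastP: p => [|p w]; first by rewrite eq_sym.
rewrite rcons_path last_rcons => /andP[_ /exists_inP[f /setD1P[_ fG]]].
by move=> /andP[/eqP/(ends_neq fG)]; rewrite eq_sym.
Qed.

(** All three are counts of the colours missing on the fan, of which there are
    [#|C| - degree G z] at [z], plus one at [x]. The first holds because these
    colours are distinct, and distinct from the colours missing at [c]; the
    second, because each of them is carried by an edge from [c] to the fan,
    besides the uncoloured one; the third looks only at the colours missing at
    [z], whose edges avoid [z]. The third one also covers [z = x], where the
    extra missing colour replaces the uncoloured edge. *)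
Theorem fan_inequalities phi e c x :
    (forall v, degree G v <= #|C|) ->
    e \in eset -> ends e = [set c; x] -> proper_on (eset :\ e) phi ->
  exists F : {set V},
    [/\ x \in F,
        \sum_(z in F) (#|C| - degree G z) + 2 <= degree G c,
        \sum_(z in F) (#|C| - degree G z) + 2 <= \sum_(z in F) mu G c z &
        forall z, z \in F -> #|C| - degree G z < \sum_(w in F :\ z) mu G c w].
Proof.
move=> degC eG ee P; pose F := fan phi e c x.
have cx := ends_neq eG ee.
have xF : x \in F by rewrite inE.
have missF z : z \in F -> #|missing phi e z| = #|C| - degree G z + (z == x).
  move=> zF; have := card_missing z eG P.
  rewrite ee !inE (negPf (fan_neq_center cx zF)) /=.
  by have := degC z; case: (z == x) => /=; lia.
have := card_missing c eG P; rewrite ee set21 => missc.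
have /card_gt0P[a ac] : 0 < #|missing phi e c| by have := degC c; lia.
pose U := \bigcup_(z in F) missing phi e z.
have cardU : #|U| = (\sum_(z in F) (#|C| - degree G z)).+1.
  rewrite card_bigcup_disjoint => [|z z' b zF z'F bz bz']; last first.
    exact: (fan_elementary eG ee P ac zF z'F bz bz').
  rewrite (eq_bigr _ missF) big_split /= -addn1; congr (_ + _).
  by rewrite (bigD1 x) //= eqxx big1 // => z /andP[_ /negPf->].
exists F; split=> //.
- have : [disjoint missing phi e c & U].
    rewrite -setI_eq0; apply/eqP/setP => b; rewrite in_setI in_set0.
    apply/andP => -[cb /bigcupP[z zF]].
    by rewrite (disjointFr (fan_center eG ee P zF) cb).
  by rewrite -leq_card_setU => /eqP; have := max_card (missing phi e c :|: U); lia.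
- have : #|U| <= #|star G c F :\ e|.
    apply: leq_trans (leq_imset_card phi _); apply/subset_leq_card/subsetP => b.
    case/bigcupP => z zF /(fan_colors eG ee P zF); apply/subsetP/imsetS/setSD.
    by apply/subsetP => f /bigcupP[w /setD1P[_ wF] fw]; apply/bigcupP; exists w.
  by rewrite cardU -card_star (cardsD1 e (star _ _ _)) (in_star F eG ee) xF; lia.
move=> z zF; have : #|missing phi e z| <= #|star G c (F :\ z) :\ e|.
  apply: leq_trans (leq_imset_card phi _); apply/subset_leq_card/subsetP => b.
  exact: fan_colors.
rewrite (missF z zF) -card_star (cardsD1 e (star _ _ _)) (in_star _ eG ee).
by rewrite in_setD1 xF andbT [x == z]eq_sym; case: (z == x) => /=; lia.
Qed.

End Fans.

(** * The discharging rule *)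

(** In units of 1/36, what a vertex of degree [k] is sent along an edge from a
    vertex of degree [m]; the unit clears the denominators of all shares and of
    the charge. The values come from two demands: a [k]-vertex adjacent to a
    vertex of small degree has at least [D - k' + 1] edges to vertices of large
    degree, where [k'] is that small degree, and must live on these; an
    [m]-vertex with a [k]-neighbour has, unless two vertices of small degree
    share a fan, at most [m + k - D - 1] edges to vertices of small degree, and
    cannot give more than its charge to them. The flag [rich] tells that a
    receiver has at least 4 edges to [D]-vertices: a 5-vertex is then content with
    a quarter of its need on each of them instead of a third. *)
Definition share (D k m : nat) (rich : bool) : nat :=
  match D, k, m with
  | 3, 2, 3 => 12
  | 4, 2, 4 => 24 | 4, 3, 4 => 6
  | 5, 2, 5 => 36 | 5, 3, 5 => 18
  | 6, 2, 6 => 48 | 6, 3, 6 => 24 | 6, 3, 5 => 12 | 6, 4, 6 => 8 | 6, 4, 5 => 6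
  | 7, 2, 7 => 60 | 7, 3, 7 => 30 | 7, 3, 6 => 24 | 7, 4, 7 => 16 | 7, 4, 6 => 12
  | 7, 5, 7 => if rich then 3 else 4 | 7, 5, 6 => if rich then 0 else 4
  | 8, 2, 8 => 72 | 8, 3, 8 => 36 | 8, 3, 7 => 36 | 8, 4, 8 => 24 | 8, 4, 7 => 18
  | 8, 5, 8 => if rich then 9 else 12 | 8, 5, 7 => if rich then 0 else 12
  | _, _, _ => 0
  end.

(** Here [n j] stands for the number of edges from a vertex of degree [m] to
    vertices of degree [j]. In the first exception the vertex looks like the
    [D]-vertex of the triangle with multiplicities 3, 4 and 1; the second is
    modelled on the triangle with multiplicities 4, 4 and 1. *)
Lemma degree_counts_balance (D m : nat) (n : nat -> nat) :
  D \in [:: 2; 3; 4; 5; 6; 7; 8] -> 0 < m <= D ->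
  \sum_(j < D.+1) n j = m ->
  (forall k, k <= D -> 0 < n k ->
     D - k < \sum_(j < D.+1) n j * (2 * D + 2 <= m + k + j)) ->
  [\/ 12 * (2 * D + 2) + \sum_(j < D.+1) n j * share D j m false
      <= 36 * m + \sum_(j < D.+1) n j * share D m j (4 <= n D),
      [&& D == 7, m == 7, n 4 == 3 & n 5 == 4] |
      [&& D == 8, m == 8 & 7 <= n 5]].
Proof.
rewrite !inE => HD Hm Hs Hp.
(* Degrees 0 and 1 are included: the hypothesis shows that they do not occur. *)
have Hp' k : (k <= D) ==> (0 < n k) ==>
     (D - k < \sum_(j < D.+1) n j * (2 * D + 2 <= m + k + j)).
  by apply/implyP => kD; apply/implyP; apply: Hp.
have {Hp} := (Hp' 0, Hp' 1, Hp' 2, Hp' 3, Hp' 4, Hp' 5, Hp' 6, Hp' 7, Hp' 8) => {Hp'}.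
move: Hs.
do 6? [case/orP: HD => [/eqP E | HD]]; last (move/eqP: HD => E); subst D;
  rewrite !big_ord_recl !big_ord0 /bump /=;
  move: (n 0) (n 1) (n 2) (n 3) (n 4) (n 5) (n 6) (n 7) (n 8)
    => n0 n1 n2 n3 n4 n5 n6 n7 n8;
case: m Hm => [|m] Hm; first lia.
all: do 8? [case: m Hm => [|m] Hm]; rewrite ?muln0 ?muln1 ?addn0 /=; try (exfalso; lia).
all: rewrite ?muln0 ?muln1 ?addn0 /= ?muln0 ?muln1 ?addn0.
all: move=> Hs [[[[[[[[h0 h1] h2] h3] h4] h5] h6] h7] h8].
all: try (exfalso; lia).
all: try (constructor 1; try case: ifP => ?; lia).
- by have [?|?] := boolP ((n4 == 3) && (n5 == 4)); [constructor 2 | constructor 1; lia].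
by have [?|?] := boolP (6 < n5); [constructor 3 | constructor 1; lia].
Qed.

(** * Colourings of critical graphs *)

Section Criticality.
Variables V E : finType.
Implicit Types G H : mgraph V E.

Lemma chromatic_index_leq H k (phi : E -> 'I_k) :
  proper_on H (eset H) phi -> chromatic_index H <= k.
Proof.
move=> P; pose Q := preim_partition phi (eset H).
have cardQ : #|Q| <= k.
  pose g a := [set f in eset H | a == phi f].
  have -> : Q = g @: (phi @: eset H) by rewrite -imset_comp.
  apply: leq_trans (leq_imset_card _ _) _.
  by apply: leq_trans (max_card _) _; rewrite card_ord.
suff mQ : matching_partition H #|Q|.
  rewrite /chromatic_index; case: ex_minnP => n _ min_n.
  exact: leq_trans (min_n _ mQ) cardQ.
apply/existsP; exists Q; rewrite preim_partitionP eqxx /=.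
apply/forall_inP => M /imsetP[e eH ->]; apply/andP; split.
  by apply/subsetP => f; rewrite inE => /andP[].
apply/forall_inP => f; rewrite !inE => /andP[fH /eqP ef].
apply/forall_inP => g; rewrite !inE => /andP[gH /eqP eg].
by apply/implyP => nfg; apply: P; rewrite -?ef.
Qed.

Lemma chromatic_index_proper H k : 0 < k -> chromatic_index H <= k ->
  exists phi : E -> 'I_k, proper_on H (eset H) phi.
Proof.
case: k => // k _; rewrite /chromatic_index; case: ex_minnP => n.
case/existsP => Q /and3P[pQ /eqP <- /forall_inP mQ] _ ltQ.
have coverQ f : f \in eset H -> pblock Q f \in Q.
  by move=> fH; rewrite pblock_mem // (cover_partition pQ).
pose idx f := index (pblock Q f) (enum Q).
have idx_lt f : f \in eset H -> idx f < k.+1.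
  by move=> /coverQ fQ; apply: leq_trans ltQ; rewrite cardE index_mem mem_enum.
exists (fun f => inord (idx f)) => f g fH gH nfg /(congr1 val) /=.
rewrite !inordK ?idx_lt // /idx => Efg.
have {}Efg : pblock Q f = pblock Q g.
  have ix e : e \in eset H -> nth set0 (enum Q) (idx e) = pblock Q e.
    by move=> /coverQ eQ; rewrite nth_index ?mem_enum.
  by rewrite -(ix f fH) -(ix g gH) /idx Efg.
have /andP[_ /forall_inP/(_ f)] := mQ _ (coverQ f fH).
rewrite mem_pblock (cover_partition pQ) fH => /(_ isT)/forall_inP/(_ g).
by rewrite Efg mem_pblock (cover_partition pQ) gH nfg => /(_ isT).
Qed.

Lemma delete_edge_sub G e f :
  f \in eset G :\ e -> ends G f \subset vset G.
Proof. by case/setD1P=> _; apply: ends_sub. Qed.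

Lemma delete_edge_card G e f : f \in eset G :\ e -> #|ends G f| = 2.
Proof. by case/setD1P=> _; apply: card_ends. Qed.

Definition delete_edge G e : mgraph V E :=
  MGraph (@delete_edge_sub G e) (@delete_edge_card G e).

Lemma delta_critical_uncolorable D G : delta_critical D G ->
  forall phi : E -> 'I_D, ~ proper_on G (eset G) phi.
Proof. by case=> _ chi _ phi /chromatic_index_leq; rewrite chi ltnn. Qed.

Lemma delta_critical_delete_edge D G e : 0 < D -> delta_critical D G ->
  e \in eset G -> exists phi : E -> 'I_D, proper_on G (eset G :\ e) phi.
Proof.
move=> D0 [_ chi crit] eG.
have /crit : proper_subgraph (delete_edge G e) G.
  split; first by split=> //=; apply: subsetDl.
  by case=> _ /= /setP/(_ e); rewrite !inE eqxx eG.
by rewrite chi ltnS => /(chromatic_index_proper D0).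
Qed.

Lemma degree0_ends G v e : degree G v = 0 -> e \in eset G -> v \notin ends G e.
Proof.
move=> /eqP; rewrite cards_eq0 => /eqP/setP/(_ e); rewrite !inE => + eG.
by rewrite eG /= => ->.
Qed.

Lemma delete_isolated_sub G v (v0 : degree G v = 0) f :
  f \in eset G -> ends G f \subset vset G :\ v.
Proof. by move=> fG; rewrite subsetD1 ends_sub // degree0_ends. Qed.

Lemma delta_critical_degree_gt0 D G v : 0 < D -> delta_critical D G ->
  v \in vset G -> 0 < degree G v.
Proof.
move=> D0 hG vG; rewrite lt0n; apply/eqP => v0.
pose H := MGraph (delete_isolated_sub v0) (@card_ends _ _ G).
have [_ chi crit] := hG.
have /crit : proper_subgraph H G.
  split; first by split=> //=; apply: subsetDl.
  by case=> /= /setP/(_ v); rewrite !inE eqxx vG.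
rewrite chi ltnS => /(chromatic_index_proper D0)[phi].
exact: (delta_critical_uncolorable hG).
Qed.

End Criticality.

(** * Discharging *)

Section Discharging.
Variables (V E : finType) (G : mgraph V E) (D : nat).
Hypotheses (hG : delta_critical D G) (D_gt0 : 0 < D).

Local Notation d := (degree G).
Local Notation mu := (mu G).

Lemma mu_gt0_vset v w : 0 < mu v w -> v \in vset G.
Proof.
case/card_gt0P => f; rewrite inE => /andP[/ends_sub/subsetP sf /eqP ef].
by apply: sf; rewrite ef set21.
Qed.

Lemma degree_leq v : d v <= D.
Proof.
case: (hG) => <- _ _; have [vG|vG] := boolP (v \in vset G).
  exact: leq_bigmax_cond.
suff -> : d v = 0 by [].
rewrite degree_mu big1 // => w _; apply/eqP; rewrite -leqn0 leqNgt.
by apply: contra vG; apply: mu_gt0_vset.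
Qed.

Lemma fan_ex c x : 0 < mu c x ->
  exists F : {set V},
    [/\ x \in F,
        \sum_(z in F) (D - d z) + 2 <= d c,
        \sum_(z in F) (D - d z) + 2 <= \sum_(z in F) mu c z &
        forall z, z \in F -> D - d z < \sum_(w in F :\ z) mu c w].
Proof.
case/card_gt0P => e; rewrite inE => /andP[eG /eqP ee].
have [phi P] := delta_critical_delete_edge D_gt0 hG eG.
have := @fan_inequalities V E G 'I_D (delta_critical_uncolorable hG) phi e c x.
by rewrite card_ord; apply=> //; apply: degree_leq.
Qed.

Definition nb v k := \sum_(w | d w == k) mu v w.

Lemma sum_nb v (h : nat -> nat) :
  \sum_w mu v w * h (d w) = \sum_(j < D.+1) nb v j * h j.
Proof.
have dD w : d w < D.+1 by rewrite ltnS degree_leq.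
rewrite (partition_big (fun w => Ordinal (dD w)) xpredT) //=.
apply: eq_bigr => j _; rewrite big_distrl /=; apply: eq_big => [w|w /eqP <-] //.
Qed.

Lemma sum_nb1 v : \sum_(j < D.+1) nb v j = d v.
Proof.
rewrite degree_mu; transitivity (\sum_(j < D.+1) nb v j * 1).
  by apply: eq_bigr => j _; rewrite muln1.
by rewrite -(sum_nb v (fun=> 1)); apply: eq_bigr => j _; rewrite muln1.
Qed.

Lemma nb_mu v w : mu v w <= nb v (d w).
Proof. by rewrite /nb (bigD1 w) //= leq_addr. Qed.

Lemma nb_gt0 v k : 0 < nb v k -> exists2 w, d w = k & 0 < mu v w.
Proof.
rewrite lt0n sum_nat_eq0 negb_forall => /existsP[w].
by rewrite negb_imply -lt0n => /andP[/eqP dw ?]; exists w.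
Qed.

(** For [x] a neighbour of degree [k], the edges counted by the fan inequality
    at [x] all end in vertices [w] of the fan other than [x], and the first
    inequality, restricted to [x] and [w], bounds [d w] from below. *)
Lemma adjacency v k : 0 < nb v k ->
  D - k < \sum_(j < D.+1) nb v j * (2 * D + 2 <= d v + k + j).
Proof.
case/nb_gt0 => x <- /fan_ex[F [xF F1 _ F3]]; apply: leq_trans (F3 x xF) _.
rewrite -(sum_nb v (fun j => (2 * D + 2 <= d v + d x + j) : nat)) big_mkcond /=.
apply: leq_sum => w _; case: ifP => // /setD1P[nwx wF].
have /= := sum2_leq (fun z => D - d z) xF wF nwx; have := degree_leq x.
by have := degree_leq w; case: leqP; lia.
Qed.

Definition rich v := 4 <= nb v D.

Definition sent v := \sum_u mu v u * share D (d u) (d v) (rich u).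
Definition received v := \sum_u mu v u * share D (d v) (d u) (rich v).

Lemma share_rich k m r : share D k m r <= share D k m false.
Proof.
rewrite /share.
repeat match goal with
  | |- is_true (leq (match ?x with _ => _ end) _) => destruct x => //
end.
Qed.

Lemma sent_leq v : sent v <= \sum_(j < D.+1) nb v j * share D j (d v) false.
Proof.
rewrite -(sum_nb v (fun j => share D j (d v) false)).
by apply: leq_sum => u _; rewrite leq_mul2l share_rich orbT.
Qed.

Lemma receivedE v :
  received v = \sum_(j < D.+1) nb v j * share D (d v) j (rich v).
Proof. by rewrite -(sum_nb v (fun j => share D (d v) j (rich v))). Qed.

Lemma mu_in_nb v w : 0 < mu v w -> 0 < nb v (d w).
Proof. by move=> vw; apply: leq_trans vw (nb_mu v w). Qed.

(** The fan of a 4-neighbour [x] has room for a single 5-vertex [w], so all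
    edges from [v] to the fan other than those to [x] end in [w]. There are at
    least four of them, which makes [w] rich and saves one unit on each. The
    constant is [12 * (2 * D + 2)], as in [degree_counts_balance]. *)
Lemma sent_fat7 v : D = 7 -> d v = 7 -> nb v 4 = 3 -> nb v 5 = 4 ->
  192 + sent v <= 36 * d v.
Proof.
move=> D7 dv n4 n5.
have n_other j : j <= 7 -> j != 4 -> j != 5 -> nb v j = 0.
  have := sum_nb1 v; rewrite dv D7 !big_ord_recl !big_ord0 /= /bump /=.
  rewrite !(add1n, addn0) n4 n5.
  by do 8? [case: j => [|j]]; lia.
have d45 w : 0 < mu v w -> d w = 4 \/ d w = 5.
  move=> /mu_in_nb; have := degree_leq w; rewrite D7 => dw.
  have [->|n4w] := eqVneq (d w) 4; first by left.
  have [->|n5w] := eqVneq (d w) 5; first by right.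
  by rewrite n_other.
have [x dx vx] : exists2 x, d x = 4 & 0 < mu v x by apply: nb_gt0; rewrite n4.
have [F [xF F1 _ /(_ x xF)]] := fan_ex vx; rewrite D7 dx => F3.
have [w /andP[wF vw]] : exists w, (w \in F :\ x) && (0 < mu v w).
  apply/existsP; apply: contraTT F3; rewrite negb_exists => /forallP H.
  by rewrite big1 // => w wF; have := H w; rewrite wF -leqNgt leqn0 => /eqP.
have /setD1P[nwx wF'] := wF.
have dw : d w = 5.
  have /= := sum2_leq (fun z => D - d z) xF wF' nwx.
  by case: (d45 w vw) => //; lia.
have {}F3 : 4 <= mu v w.
  move: F3; rewrite (bigD1 w) //= big1 ?addn0 // => u /andP[/setD1P[nux uF] nuw].
  apply/eqP; rewrite -leqn0 leqNgt; apply/negP => vu.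
  have /= := sum3_leq (fun z => D - d z) xF wF' uF nwx nux nuw.
  by case: (d45 u vu); lia.
have rw : rich w.
  by rewrite /rich D7 -dv; apply: leq_trans (nb_mu w v); rewrite muC.
have : sent v + 4 <= \sum_(j < D.+1) nb v j * share D j (d v) false.
  rewrite -(sum_nb v (fun j => share D j (d v) false)) /sent.
  rewrite (bigD1 w) //= [in leqRHS](bigD1 w) //= addnAC leq_add //.
    by rewrite D7 dw dv rw /=; lia.
  by apply: leq_sum => u _; rewrite leq_mul2l share_rich orbT.
rewrite dv D7 !big_ord_recl !big_ord0 /= /bump /= !(add1n, addn0) n4 n5.
by rewrite (n_other 2) // (n_other 3) //; lia.
Qed.

(** The fan of a 5-neighbour [x] contains another 5-neighbour [z], and the
    colours missing at both use up all eight edges at [v]. Hence [x] and [z] are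
    the only neighbours of degree less than 8, and [v] can afford to meet the
    needs of both, 36 units each: a vertex with four edges to [v] is rich, and
    more than four would leave too few edges to the rest of the fan. *)
Lemma sent_twin8 v : D = 8 -> d v = 8 -> 7 <= nb v 5 ->
  216 + sent v <= 36 * d v.
Proof.
move=> D8 dv n5.
have [x dx vx] : exists2 x, d x = 5 & 0 < mu v x by apply: nb_gt0; lia.
have [F [xF F1 F2 F3]] := fan_ex vx.
have [z [zF nzx dz]] : exists z, [/\ z \in F, z != x & d z = 5].
  have : ~~ [forall w, (w \in F :\ x) ==> (d w != 5)].
    apply: contraL (F3 x xF) => /forall_inP H; rewrite dx D8 -leqNgt.
    have : \sum_w mu v w * (d w != 5) <= 1.
      rewrite (sum_nb v (fun j => (j != 5) : nat)).
      have := sum_nb1 v; rewrite dv D8 !big_ord_recl !big_ord0 /= /bump /=.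
      by rewrite !(add1n, addn0) ?muln0 ?muln1; lia.
    suff : \sum_(w in F :\ x) mu v w <= \sum_w mu v w * (d w != 5) by lia.
    by rewrite big_mkcond; apply: leq_sum => w _; case: ifP => // /H ->; lia.
  rewrite negb_forall => /existsP[z]; rewrite negb_imply negbK.
  by move=> /andP[/setD1P[? ?] /eqP ?]; exists z.
have sumF : \sum_(w in F) mu v w = 8.
  have /= := sum2_leq (fun z => D - d z) xF zF nzx.
  suff : \sum_(w in F) mu v w <= d v by lia.
  by rewrite degree_mu [leqRHS](bigID (mem F)) leq_addr.
have outF w : w \notin F -> mu v w = 0.
  move=> wF; move: dv; rewrite degree_mu (bigID (mem F)) /= sumF (bigD1 w) //=; lia.
have at_most u : u \in F -> d u = 5 -> mu v u * share D (d u) (d v) (rich u) <= 36.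
  move=> uF du; have mu4 : mu v u <= 4.
    have := F3 u uF; move: sumF; rewrite (big_setD1 u uF) /= du D8; lia.
  rewrite D8 dv du /=; have [|lt4] := leqP 4 (mu v u); last by case: ifP; lia.
  move=> ge4; suff -> : rich u by lia.
  by rewrite /rich D8 -dv; apply: leq_trans (nb_mu u v); rewrite muC.
have nothing w : w != x -> w != z ->
    mu v w * share D (d w) (d v) (rich w) = 0.
  move=> nwx nwz; have [wF|/outF->//] := boolP (w \in F).
  have /= := sum3_leq (fun z => D - d z) xF zF wF nzx nwx nwz.
  have := degree_leq w; rewrite dx dz dv => ? ?.
  have dw : d w = 8 by lia.
  by rewrite dw D8 /= muln0.
rewrite /sent (bigD1 x) //= (bigD1 z) ?nzx //= big1 => [|w /andP[nwx nwz]]; last first.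
  exact: nothing.
by have := at_most x xF dx; have := at_most z zF dz; rewrite dv; lia.
Qed.

Lemma local_balance v : D \in [:: 2; 3; 4; 5; 6; 7; 8] -> v \in vset G ->
  12 * (2 * D + 2) + sent v <= 36 * d v + received v.
Proof.
move=> HD vG; have := @degree_counts_balance D (d v) (nb v) HD.
rewrite (delta_critical_degree_gt0 D_gt0 hG vG) degree_leq -receivedE.
case=> // [|k _|ok|/and4P[/eqP D7 /eqP dv /eqP n4 /eqP n5]|/and3P[/eqP D8 /eqP dv n5]].
- exact: sum_nb1.
- exact: adjacency.
- by have := sent_leq v; lia.
- by have := sent_fat7 D7 dv n4 n5; lia.
- by have := sent_twin8 D8 dv n5; lia.
Qed.

Lemma handshake : \sum_(v in vset G) d v = 2 * #|eset G|.
Proof.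
rewrite (eq_bigr (fun v => \sum_(e in eset G | v \in ends G e) 1)) => [|v _]; last first.
  by rewrite sum1dep_card; apply: eq_card => e; rewrite !inE.
rewrite (exchange_big_dep (mem (eset G))) //=; last by move=> v e _ /andP[].
rewrite (eq_bigr (fun=> 2)) => [|e eG]; first by rewrite sum_nat_const mulnC.
rewrite sum1dep_card -(card_ends eG); apply: eq_card => v; rewrite !inE eG /=.
by apply: andb_idl; apply: (subsetP (ends_sub eG)).
Qed.

Lemma sum_sent : \sum_(v in vset G) sent v = \sum_(v in vset G) received v.
Proof.
have out v w : v \notin vset G -> mu v w = 0.
  by move=> vG; apply/eqP; rewrite -leqn0 leqNgt; apply: contra vG; apply: mu_gt0_vset.
rewrite big_mkcond [RHS]big_mkcond /=.
rewrite (eq_bigr (fun v => sent v)) => [|v _]; last first.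
  by case: ifPn => // vG; rewrite /sent big1 // => w _; rewrite out.
rewrite [RHS](eq_bigr (fun v => received v)) => [|v _]; last first.
  by case: ifPn => // vG; rewrite /received big1 // => w _; rewrite out.
by rewrite exchange_big; apply: eq_bigr => v _; apply: eq_bigr => w _; rewrite muC.
Qed.

Lemma degree_sum_bound : D \in [:: 2; 3; 4; 5; 6; 7; 8] ->
  (2 * D + 2) * #|vset G| <= 3 * (2 * #|eset G|).
Proof.
move=> HD; rewrite -handshake.
have : \sum_(v in vset G) (12 * (2 * D + 2) + sent v)
       <= \sum_(v in vset G) (36 * d v + received v).
  by apply: leq_sum => v; apply: local_balance.
rewrite [leqLHS]big_split [leqRHS]big_split /= sum_sent leq_add2r sum_nat_const.
by rewrite -big_distrr /=; lia.
Qed.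

End Discharging.

Theorem theorem1p2 (V E : finType) (G : mgraph V E) (D : nat)
    (hG : delta_critical D G) (hD : D \in [:: 2; 3; 4; 5; 6; 7; 8]) :
  (average_degree G >= (2 * D + 2)%N%:R / 3%:R)%R.
Proof.
have D_gt0 : 0 < D by case: D hD {hG}.
have V_gt0 : 0 < #|vset G|.
  rewrite lt0n; apply: contraTneq D_gt0 => /eqP; rewrite cards_eq0 => /eqP V0.
  by case: hG => <- _ _; rewrite /max_degree V0 big_set0.
rewrite /average_degree ler_pdivlMr ?ltr0n // mulrAC ler_pdivrMr ?ltr0n //.
by rewrite -!natrM ler_nat [leqRHS]mulnC degree_sum_bound.
Qed.
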